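(* Let $Q$ be the finite bounded graded poset of rank $4$ with elements $\hat 0, x_1,x_2,y_1,y_2,y_3,y_4,z_1,z_2,z_3,z_4,\hat 1$ whose cover relations are exactly the following: $\hat 0\lessdot x_1$, $\hat 0\lessdot x_2$; $x_1\lessdot y_1,y_2,y_3$; $x_2\lessdot y_2,y_3,y_4$; $y_1\lessdot z_1,z_2$; $y_2\lessdot z_2,z_3$; $y_3\lessdot z_2,z_3$; $y_4\lessdot z_3,z_4$; and $z_i\lessdot \hat 1$ for $i=1,2,3,4$. Then $Q$ is EL-shellable.
   Context: Write $s\lessdot t$ if $t$ covers $s$; the notation $x\lessdot a,b,c$ means that $x$ is covered by each of $a,b,c$. For a finite graded bounded poset $P$, let $\mathcal{E}(P)$ be the set of pairs $(s,t)$ with $s\lessdot t$. An edge labeling is a map $\lambda:\mathcal{E}(P)\to\Lambda$, where $\Lambda$ is a totally ordered set. A maximal chain $s=u_0\lessdot u_1\lessdot\cdots\lessdot u_k=t$ of the interval $[s,t]$ has label word $\lambda(u_0,u_1)\cdots\lambda(u_{k-1},u_k)$. The labeling $\lambda$ is an EL-labeling if for all $s\leqslant t$ in $P$ there is a unique maximal chain of $[s,t]$ whose label word is weakly increasing (as the rank increases), and this chain's label word is lexicographically minimal among the label words of all maximal chains of $[s,t]$. $P$ is EL-shellable if it admits an EL-labeling (for some totally ordered set $\Lambda$). *)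

(* Defs.v *)
From HB Require Import structures.
From mathcomp Require Import all_boot all_order.

Set Implicit Arguments.
Unset Strict Implicit.
Unset Printing Implicit Defensive.

Import Order.Theory.
Local Open Scope order_scope.

Definition covers {d : Order.disp_t} {P : finPOrderType d} : rel P :=
  fun s t => (s < t) && [forall u, ~~ (s < u < t)].

(* The chain s = u_0 <. u_1 <. ... <. u_k = t is encoded, as in path.v, by s
   and the sequence [:: u_1; ...; u_k]; it is empty exactly when s = t. *)
Definition max_chain {d : Order.disp_t} {P : finPOrderType d} (s t : P)
    (c : seq P) : bool :=
  path covers s c && (last s c == t).

Definition graded_of_rank {d : Order.disp_t} (P : finTBPOrderType d) (n : nat) :
    Prop :=
  forall c : seq P, max_chain \bot \top c -> size c = n.

(* An edge labeling is represented by a function on all pairs; only its values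
   on the pairs (s, t) with [covers s t] are ever used, because label words are
   taken along maximal chains. *)
Definition label_word {d d' : Order.disp_t} {P : finPOrderType d}
    {L : orderType d'} (lambda : P -> P -> L) (s : P) (c : seq P) : seq L :=
  pairmap lambda s c.

Definition weakly_increasing {d' : Order.disp_t} {L : orderType d'}
    (w : seq L) : bool :=
  sorted <=%O w.

Definition lex_le {d' : Order.disp_t} {L : orderType d'} (v w : seq L) : bool :=
  (v : seqlexi L) <= (w : seqlexi L).

Definition EL_labeling {d d' : Order.disp_t} {P : finTBPOrderType d}
    {L : orderType d'} (lambda : P -> P -> L) : Prop :=
  forall s t : P, s <= t ->
  exists c : seq P,
    [/\ max_chain s t c,
        weakly_increasing (label_word lambda s c),
        forall c' : seq P, max_chain s t c' ->
          weakly_increasing (label_word lambda s c') -> c' = c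
      & forall c' : seq P, max_chain s t c' ->
          lex_le (label_word lambda s c) (label_word lambda s c')].

Definition EL_shellable {d : Order.disp_t} (P : finTBPOrderType d) : Prop :=
  exists (d' : Order.disp_t) (L : orderType d') (lambda : P -> P -> L),
    EL_labeling lambda.

Inductive Q : Set :=
  | zero | x1 | x2 | y1 | y2 | y3 | y4 | z1 | z2 | z3 | z4 | one.

Definition Q_seq : seq Q :=
  [:: zero; x1; x2; y1; y2; y3; y4; z1; z2; z3; z4; one].

Definition Q_code (s : Q) : nat :=
  match s with
  | zero => 0 | x1 => 1 | x2 => 2 | y1 => 3 | y2 => 4 | y3 => 5 | y4 => 6
  | z1 => 7 | z2 => 8 | z3 => 9 | z4 => 10 | one => 11
  end.

Lemma Q_codeK : cancel Q_code (nth zero Q_seq). Proof. by case. Qed.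

HB.instance Definition _ := Countable.copy Q (can_type Q_codeK).

Lemma Q_seqP : Finite.axiom Q_seq. Proof. by case. Qed.

HB.instance Definition _ := isFinite.Build Q Q_seqP.

Definition Q_up (s : Q) : seq Q :=
  match s with
  | zero => [:: x1; x2]
  | x1 => [:: y1; y2; y3]
  | x2 => [:: y2; y3; y4]
  | y1 => [:: z1; z2]
  | y2 => [:: z2; z3]
  | y3 => [:: z2; z3]
  | y4 => [:: z3; z4]
  | z1 | z2 | z3 | z4 => [:: one]
  | one => [::]
  end.

(* The order of Q is the reflexive transitive closure of the listed relations;
   [coversQ] below checks that its covering relation is again [Q_up]. *)
Definition Q_le : rel Q := connect (grel Q_up).

Definition Q_rank (s : Q) : nat :=
  match s with
  | zero => 0 | x1 | x2 => 1 | y1 | y2 | y3 | y4 => 2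
  | z1 | z2 | z3 | z4 => 3 | one => 4
  end.

Lemma Q_rank_up s t : t \in Q_up s -> Q_rank t = (Q_rank s).+1.
Proof. by case: s; case: t. Qed.

Lemma Q_rank_path s c :
  path (grel Q_up) s c -> Q_rank (last s c) = (Q_rank s + size c)%N.
Proof.
elim: c s => [|u c IH] s /=; first by rewrite addn0.
by case/andP=> /Q_rank_up su /IH ->; rewrite su addnS.
Qed.

Lemma Q_le_rank s t : Q_le s t -> (s == t) || (Q_rank s < Q_rank t)%N.
Proof.
case/connectP=> c sc ->; rewrite Q_rank_path //.
by case: c sc => [|u c] _ /=; rewrite ?eqxx // addnS ltnS leq_addr orbT.
Qed.

Lemma Q_le_refl : reflexive Q_le. Proof. exact: connect0. Qed.

Lemma Q_le_trans : transitive Q_le. Proof. exact: connect_trans. Qed.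

Lemma Q_le_anti : antisymmetric Q_le.
Proof.
move=> s t /andP[/Q_le_rank/orP[/eqP //|st] /Q_le_rank/orP[/eqP //|ts]].
by have := ltn_trans st ts; rewrite ltnn.
Qed.

HB.instance Definition _ :=
  Order.Le_isPOrder.Build (Order.Disp tt tt) Q Q_le_refl Q_le_anti Q_le_trans.

Lemma Q_le0x s : zero <= s.
Proof.
have up u v w : Q_le u v -> w \in Q_up v -> Q_le u w.
  by move=> uv vw; apply: Q_le_trans uv (connect1 _).
have h0 := Q_le_refl zero.
have hx1 : Q_le zero x1 by exact: up h0 _.
have hx2 : Q_le zero x2 by exact: up h0 _.
have hy1 : Q_le zero y1 by exact: up hx1 _.
have hy2 : Q_le zero y2 by exact: up hx1 _.
have hy3 : Q_le zero y3 by exact: up hx1 _.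
have hy4 : Q_le zero y4 by exact: up hx2 _.
have hz1 : Q_le zero z1 by exact: up hy1 _.
have hz2 : Q_le zero z2 by exact: up hy1 _.
have hz3 : Q_le zero z3 by exact: up hy4 _.
have hz4 : Q_le zero z4 by exact: up hy4 _.
have h1 : Q_le zero one by exact: up hz1 _.
by case: s.
Qed.

Lemma Q_lex1 s : s <= one.
Proof.
have up u v : v \in Q_up u -> Q_le v one -> Q_le u one.
  by move=> uv; apply: Q_le_trans (connect1 _).
have h1 := Q_le_refl one.
have hz1 : Q_le z1 one by exact: up h1.
have hz2 : Q_le z2 one by exact: up h1.
have hz3 : Q_le z3 one by exact: up h1.
have hz4 : Q_le z4 one by exact: up h1.
have hy1 : Q_le y1 one by exact: up hz1.
have hy2 : Q_le y2 one by exact: up hz2.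
have hy3 : Q_le y3 one by exact: up hz2.
have hy4 : Q_le y4 one by exact: up hz4.
have hx1 : Q_le x1 one by exact: up hy1.
have hx2 : Q_le x2 one by exact: up hy4.
have h0 : Q_le zero one by exact: up hx1.
by case: s.
Qed.

HB.instance Definition _ :=
  Order.hasBottom.Build (Order.Disp tt tt) Q Q_le0x.
HB.instance Definition _ :=
  Order.hasTop.Build (Order.Disp tt tt) Q Q_lex1.

Lemma Q_lt_rank (s t : Q) : s < t -> (Q_rank s < Q_rank t)%N.
Proof.
by rewrite lt_neqAle => /andP[/negPf st /Q_le_rank]; rewrite st.
Qed.

Lemma coversQ (s t : Q) : covers s t = (t \in Q_up s).
Proof.
have ltup (u v : Q) : v \in Q_up u -> u < v.
  move=> uv; rewrite lt_neqAle; apply/andP; split; last exact: connect1.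
  by apply/eqP => e; have := Q_rank_up uv; rewrite e => /n_Sn.
apply/andP/idP => [[st /forallP no]|st].
  have /connectP[[|u c] /= sc e] := ltW st; first by rewrite e ltxx in st.
  case/andP: sc => su uc; have ut : Q_le u t by apply/connectP; exists c.
  have [<- // | ne] := eqVneq u t.
  by have := no u; rewrite (ltup _ _ su) lt_neqAle ne [_ <= _]ut.
split; first exact: ltup.
apply/forallP => u; apply/negP => /andP[/Q_lt_rank su /Q_lt_rank].
by rewrite (Q_rank_up st) ltnS leqNgt su.
Qed.

Lemma Q_graded : graded_of_rank Q 4.
Proof.
move=> c /andP[]; rewrite (eq_path (e' := grel Q_up)) => [/Q_rank_path e|];
  last exact: coversQ.
by move/eqP=> e'; rewrite e' in e; move: e; rewrite add0n.
Qed.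

(* Main.v *)
Require Import Defs.
From mathcomp Require Import all_boot all_order.

(** The natural-number labeling [Q_label] below is an EL-labeling.

    Every edge into the top has label 0, so a weakly increasing word of an
    interval [s, one] is constantly 0.  Each s other than the top has exactly
    one outgoing edge labeled 0, so following these edges gives the only weakly
    increasing maximal chain of [s, one], and its word is minimal because 0 is the
    least label.

    Among the intervals with another upper end, those from zero to some z_i are
    the longest.  Here [zero, z1] and [zero, z4] are single chains, with words
    000 and 333.  The words of the maximal chains of [zero, z2] are 001, 010,
    020, 300 and 320, and those of [zero, z3] are 011, 021, 301, 321 and 330;
    in both cases only the first is weakly increasing, and it is the minimal
    one.  The large label 3 of the edge from zero to x2 forces a descent on the
    chains through x2 that compete with chains through x1, and the edges from
    x2 to y4 and from y4 to z4 repeat it because the single maximal chain of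
    [zero, z4] must not descend.  The intervals of length 2 are
    treated in the same way.

    As Q is small, all intervals are checked by computation: [Q_chains] lists
    the saturated chains from a given element ([mem_Q_chains]), and
    [EL_intervalP] turns the conditions on an interval into a boolean test over
    that list. *)

Set Implicit Arguments.
Unset Strict Implicit.
Unset Printing Implicit Defensive.

Local Open Scope order_scope.

(** The default value 0 is the label of the edges z_i -- one and of the first
    edge out of each other element. *)
Definition Q_label (s t : Q) : nat :=
  match s, t with
  | zero, x2 => 3
  | x1, y2 => 1 | x1, y3 => 2
  | x2, y3 => 2 | x2, y4 => 3
  | y1, z2 => 1
  | y2, z3 => 1
  | y3, z3 => 1
  | y4, z4 => 3
  | _, _ => 0
  end.

(** Chains are represented without their first element s, as in [max_chain];
    n bounds their length. *)
Fixpoint Q_chains (n : nat) (s : Q) : seq (seq Q) :=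
  if n is n'.+1 then
    [::] :: flatten [seq map (cons u) (Q_chains n' u) | u <- Q_up s]
  else [:: [::]].

Lemma mem_Q_chains n (s : Q) (c : seq Q) :
  (c \in Q_chains n s) = path covers s c && (size c <= n)%N.
Proof.
elim: n s c => [|n IH] s [|u c] //=; first by rewrite inE andbF.
rewrite inE /= ltnS coversQ.
apply/flatten_mapP/idP => [[v sv /mapP[c' c'v [-> ->]]]|].
  by rewrite sv -IH.
rewrite -andbA => /andP[su uc]; exists u => //.
by rewrite map_f // IH.
Qed.

Lemma size_Q_chain (s : Q) (c : seq Q) : path covers s c -> (size c <= 4)%N.
Proof.
rewrite (eq_path (e' := grel Q_up)); last exact: coversQ.
move/Q_rank_path => e; apply: leq_trans (leq_addl (Q_rank s) _) _.
by rewrite -e; case: (last s c).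
Qed.

Definition Q_max_chains (s t : Q) : seq (seq Q) :=
  [seq c <- Q_chains 4 s | last s c == t].

Lemma mem_Q_max_chains (s t : Q) (c : seq Q) :
  (c \in Q_max_chains s t) = max_chain s t c.
Proof.
rewrite mem_filter mem_Q_chains /max_chain.
case sc: (path covers s c); last by rewrite andbF.
by rewrite (size_Q_chain sc) !andbT.
Qed.

Lemma Q_max_chains_nonnil (s t : Q) : s <= t -> Q_max_chains s t != [::].
Proof.
case/connectP=> c sc ->.
have: c \in Q_max_chains s (last s c).
  by rewrite mem_Q_max_chains /max_chain eqxx andbT (eq_path coversQ).
by case: (Q_max_chains _ _).
Qed.

(** Pairs s, t without s <= t pass the test because they have no maximal
    chain, so that the test never has to decide the order of Q. *)
Definition EL_interval (s t : Q) : bool :=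
  let C := Q_max_chains s t in
  if [seq c <- C | weakly_increasing (label_word Q_label s c)] is [:: c] then
    all (fun c' => lex_le (label_word Q_label s c) (label_word Q_label s c')) C
  else C == [::].

Lemma EL_intervalP (s t : Q) : s <= t -> EL_interval s t ->
  exists c : seq Q,
    [/\ max_chain s t c,
        weakly_increasing (label_word Q_label s c),
        forall c' : seq Q, max_chain s t c' ->
          weakly_increasing (label_word Q_label s c') -> c' = c
      & forall c' : seq Q, max_chain s t c' ->
          lex_le (label_word Q_label s c) (label_word Q_label s c')].
Proof.
move=> /Q_max_chains_nonnil/negPf C0; rewrite /EL_interval C0.
case E: [seq _ <- _ | _] => [|c [|//]] // /allP lec.
have incE c' : max_chain s t c' && weakly_increasing (label_word Q_label s c')
    = (c' == c).
  by rewrite -mem_seq1 -E mem_filter mem_Q_max_chains andbC.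
have /andP[sc ic]: max_chain s t c && weakly_increasing (label_word Q_label s c).
  by rewrite incE.
exists c; split=> // c' sc'.
  by move=> ic'; apply/eqP; rewrite -incE sc' ic'.
by apply: lec; rewrite mem_Q_max_chains.
Qed.

Lemma EL_labeling_Q_label : EL_labeling Q_label.
Proof.
move=> s t st; apply: EL_intervalP => //.
by case: s {st}; case: t; vm_compute.
Qed.

Theorem claim4p2 : EL_shellable Q.
Proof. by exists _, nat, Q_label; exact: EL_labeling_Q_label. Qed.
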